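(* Let $C_i$, $i\in I$, be polyhedral, let $\lambda_k,\mu_k\in[\varepsilon,2-\varepsilon]$, $k\ge 0$, for some $\varepsilon\in(0,1)$, and let $\{i_k\}_{k=0}^\infty\subseteq I$ be almost cyclic. Then, for every $x^0\in\mathcal{H}$, the sequence $x^k$ generated by the iteration $$x^{k+1}=P_{C_{i_k},\mu_k}\Big(x^k+\frac{\lambda_k}{\|A_{i_k}\|^2}A_{i_k}^*\big(b^{i_k}-A_{i_k}x^k\big)\Big),\qquad k\ge 0,$$ converges linearly to some $x^*\in\Omega$.
   Context: Let $\mathcal{H}$ be a real Hilbert space, let $\mathcal{H}_i$, $i\in I:=\{1,2,\dots,p\}$, be finite-dimensional real Hilbert spaces, $C_i\subseteq\mathcal{H}$ nonempty closed convex subsets, $b^i\in\mathcal{H}_i$, and $A_i:\mathcal{H}\to\mathcal{H}_i$ nonzero bounded linear operators with adjoints $A_i^*$ and operator norms $\|A_i\|$. Put $\Omega:=\{x\in\bigcap_{i=1}^pC_i: A_ix=b^i \text{ for all } i\in I\}$; it is assumed that $\Omega\neq\emptyset$. A set is polyhedral if it is the intersection of a finite family of half-spaces. $P_{C}$ is the metric projection onto $C$ and $P_{C,\mu}:=(1-\mu)\operatorname{Id}+\mu P_{C}$ is its $\mu$-relaxation. A sequence $\{i_k\}_{k=0}^\infty\subseteq I$ is almost cyclic if there is a constant $s\ge p$ such that $I\subseteq\{i_{k+1},i_{k+2},\dots,i_{k+s}\}$ for every $k\ge 0$. Linear convergence of $x^k$ to $x^*$ means that there are $c\ge 0$ and $q\in(0,1)$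 with $\|x^k-x^*\|\le c\,q^k$ for all $k\ge 0$. *)

(* Defs.v *)
From HB Require Import structures.
From mathcomp Require Import all_boot all_order all_algebra.
From mathcomp Require Import all_classical all_reals all_analysis.

Set Implicit Arguments.
Unset Strict Implicit.
Unset Printing Implicit Defensive.

Import Order.TTheory GRing.Theory Num.Theory.
Import numFieldNormedType.Exports.

Local Open Scope classical_set_scope.
Local Open Scope ring_scope.

(* [{dot V for idfun}] is the type of symmetric positive definite bilinear
   forms on V; the topology of V is the one of the norm, hence of [inner]. *)
HB.mixin Record NormedModule_isPreHilbert (R : realType) V
    of NormedModule R V := {
  inner : {dot V for (idfun : R -> R)};
  norm_inner : forall x : V, `|x| = Num.sqrt (inner x x)
}.

#[short(type="hilbertType")]
HB.structure Definition Hilbert (R : realType) :=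
  {V of CompleteNormedModule R V & NormedModule_isPreHilbert R V}.

Definition finite_dimensional (R : realType) (V : lmodType R) : Prop :=
  exists n (e : 'I_n -> V),
    forall v, exists c : 'I_n -> R, v = \sum_(i < n) c i *: e i.

Definition opnorm (R : realType) (V W : normedModType R) (f : V -> W) : R :=
  sup [set `|f x| | x in [set x : V | `|x| <= 1]].

(* For a bounded linear f, the z below exists (Riesz) and is unique; the
   default value 0 is only reached for other functions. *)
Definition adjoint (R : realType) (V W : hilbertType R) (f : V -> W)
    (y : W) : V :=
  xget 0 [set z | forall x, inner (f x) y = inner x z].

(* For C nonempty, closed and convex, the y below exists and is unique; the
   default value 0 is only reached for other sets. *)
Definition proj (R : realType) (V : hilbertType R) (C : set V) (x : V) : V :=
  xget 0 [set y | C y /\ forall z, C z -> `|x - y| <= `|x - z|].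

Definition relaxed_proj (R : realType) (V : hilbertType R) (C : set V)
    (mu : R) (x : V) : V :=
  (1 - mu) *: x + mu *: proj C x.

Definition half_space (R : realType) (V : hilbertType R) (S : set V) : Prop :=
  exists (a : V) (beta : R), a != 0 /\ S = [set x | inner a x <= beta].

(* The family may be empty: the whole space is polyhedral. *)
Definition polyhedral (R : realType) (V : hilbertType R) (C : set V) : Prop :=
  exists n (S : 'I_n -> set V),
    (forall j, half_space (S j)) /\ C = \bigcap_(j : 'I_n) S j.

Definition almost_cyclic (p : nat) (idx : nat -> 'I_p) : Prop :=
  exists2 s : nat, (p <= s)%N &
    forall (k : nat) (i : 'I_p), exists2 j : nat,
      (k.+1 <= j <= k + s)%N & idx j = i.

Definition converges_linearly (R : realType) (V : normedModType R)
    (x : nat -> V) (l : V) : Prop :=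
  exists c q : R, [/\ 0 <= c, 0 < q < 1 &
    forall k : nat, `|x k - l| <= c * q ^+ k].

Definition feasible_set (R : realType) (H : hilbertType R) (p : nat)
    (E : 'I_p -> hilbertType R) (C : 'I_p -> set H)
    (A : forall i, {linear H -> E i}) (b : forall i, E i) : set H :=
  [set x | (\bigcap_(i : 'I_p) C i) x /\ forall i, A i x = b i].

(* Main.v *)
Require Import Defs.
From HB Require Import structures.
From mathcomp Require Import all_boot all_order all_algebra.
From mathcomp Require Import all_classical all_reals all_analysis.
From mathcomp Require Import ring lra.

Import Order.TTheory GRing.Theory Num.Theory.
Import numFieldNormedType.Exports.

Local Open Scope classical_set_scope.
Local Open Scope ring_scope.

(** The argument is quantitative. Every [C i] is the solution set of finitely
    many linear inequalities, and so is the affine set [A i x = b i]: since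
    its codomain is finite-dimensional, the equation can be tested against
    finitely many vectors, that is, on finitely many functionals
    [inner (adjoint (A i) e)]. So the feasible set is the solution set of
    finitely many inequalities on a possibly infinite-dimensional space.

    For such a set the Hoffman bound holds ([hoffman_error_bound]): if all
    inequalities fail at [x] by at most [rho], then a solution lies within
    [kappa * rho] of [x], with [kappa] independent of [x] and [rho]. It is
    proved by Fourier-Motzkin elimination. Eliminating a direction [e] makes
    all normals orthogonal to [e], so the dimension of their span drops; a
    solution of the eliminated system near [x] becomes a solution of the
    original system after a move along [e] of controlled length
    ([lift_error_bound]). Only finitely many real numbers are compared in
    this argument, so the dimension of the ambient space does not matter.

    A step of the iteration is a gradient step for [`|A x - b| ^+ 2] followed
    by a relaxed projection. As both relaxation parameters stay away from 0
    and 2, the squared distance to every solution of the current system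
    decreases by some [delta ^+ 2], where [delta] controls both the length of
    the step and the residuals of the current system ([step_decrease]).

    By almost cyclicity every window of fixed length meets all systems. Short
    steps transport the residuals inside the window back to its first point
    [x k], so the total decrease over the window bounds all residuals of
    [x k], and by the Hoffman bound the squared distance from [x k] to the
    feasible set. This distance is therefore contracted by a fixed factor over
    each window ([almost_cyclic_linear_convergence]). Since distances to
    feasible points never increase, [x j] stays within twice this distance of
    [x k] for [j >= k]; the sequence is Cauchy with a geometric rate, and its
    limit is feasible. *)

(** * Inner products *)

Section InnerProduct.
Context {R : realType} {V : hilbertType R}.
Implicit Types (x y z : V) (a : R).

Lemma innerC x y : inner x y = inner y x.
Proof. by rewrite (hermC inner) expr0 mul1r. Qed.

Lemma innerDl x y z : inner (x + y) z = inner x z + inner y z.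
Proof. exact: linearDl. Qed.

Lemma innerZl a x z : inner (a *: x) z = a * inner x z.
Proof. exact: linearZl_LR. Qed.

Lemma innerNl x z : inner (- x) z = - inner x z.
Proof. exact: linearNl. Qed.

Lemma innerBl x y z : inner (x - y) z = inner x z - inner y z.
Proof. by rewrite innerDl innerNl. Qed.

Lemma innerDr x y z : inner x (y + z) = inner x y + inner x z.
Proof. by rewrite !(innerC x) innerDl. Qed.

Lemma innerZr a x z : inner x (a *: z) = a * inner x z.
Proof. by rewrite !(innerC x) innerZl. Qed.

Lemma innerNr x z : inner x (- z) = - inner x z.
Proof. by rewrite !(innerC x) innerNl. Qed.

Lemma innerBr x y z : inner x (y - z) = inner x y - inner x z.
Proof. by rewrite innerDr innerNr. Qed.

Lemma inner0l x : inner 0 x = 0.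
Proof. exact: linear0l. Qed.

Lemma inner0r x : inner x 0 = 0.
Proof. by rewrite innerC inner0l. Qed.

Definition innerE :=
  (innerBl, innerBr, innerDl, innerDr, innerNl, innerNr, innerZl, innerZr).

Lemma inner_ge0 x : 0 <= inner x x.
Proof.
have [->|x0] := eqVneq x 0; first by rewrite inner0l.
exact/ltW/neq0_dnorm_gt0.
Qed.

Lemma sqr_norm x : `|x| ^+ 2 = inner x x.
Proof. by rewrite norm_inner sqr_sqrtr ?inner_ge0. Qed.

Lemma inner_le x y : inner x y <= `|x| * `|y|.
Proof.
have [->|y0] := eqVneq y 0; first by rewrite inner0r normr0 mulr0.
have [->|x0] := eqVneq x 0; first by rewrite inner0l normr0 mul0r.
have xy_gt0 : 0 < `|x| * `|y| by rewrite mulr_gt0 ?normr_gt0.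
have := inner_ge0 (`|y| *: x - `|x| *: y).
rewrite !innerE (innerC y x) -!sqr_norm => h.
rewrite -(ler_pM2l xy_gt0); nra.
Qed.

Lemma ler_inner x y : `|inner x y| <= `|x| * `|y|.
Proof.
rewrite ler_norml inner_le andbT.
by rewrite lerNl -innerNl -(normrN x) inner_le.
Qed.

Lemma inner_eq0_all x : (forall y, inner x y = 0) -> x = 0.
Proof.
by move=> /(_ x) /eqP; rewrite -sqr_norm sqrf_eq0 normr_eq0 => /eqP.
Qed.

End InnerProduct.

(** * Completeness and metric projections *)

Lemma cauchy_rate_cvg (R : realType) (V : completeNormedModType R)
    (x : nat -> V) (e : nat -> R) :
  e @ \oo --> 0 -> (forall k j, (k <= j)%N -> `|x k - x j| <= e k) ->
  exists l, x @ \oo --> l /\ forall k, `|x k - l| <= e k.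
Proof.
move=> e0 xe.
have xc : cvg (x @ \oo).
  apply/cauchy_cvgP/cauchy_exP => d d0.
  have /cvgrPdist_lt /(_ d d0) [N _ Nd] := e0.
  exists (x N); exists N => // j Nj; rewrite -ball_normE /=.
  apply: le_lt_trans (xe _ _ Nj) _.
  by have := Nd N (leqnn N); rewrite /= sub0r normrN; apply: le_lt_trans (ler_norm _).
exists (lim (x @ \oo)); split=> // k.
apply: (@closed_cvg _ _ \oo eventually_filter x [set y | `|x k - y| <= e k]) xc.
- have -> : [set y | `|x k - y| <= e k] = closed_ball_ Num.norm (x k) (e k) by [].
  exact: closed_closed_ball_.
- by exists k => // j /= kj; exact: xe.
Qed.

Lemma ler_add_cvg0 (R : realType) (a b : R) (e : nat -> R) :
  e @ \oo --> 0 -> (forall n, a <= b + e n) -> a <= b.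
Proof.
move=> e0 abe; apply/ler_addgt0Pr => d d0.
have /cvgrPdist_lt /(_ d d0) [N _ /(_ N (leqnn N))] := e0.
rewrite /= sub0r normrN => Nd.
apply: le_trans (abe N) _; rewrite lerD2l.
exact: le_trans (ler_norm _) (ltW Nd).
Qed.

Lemma convex_setP (R : realType) (V : lmodType R) (C : set V) :
  convex_set C <->
  forall x y t, 0 <= t -> t <= 1 -> C x -> C y -> C (t *: x + (1 - t) *: y).
Proof.
split=> [Cc x y t t0 t1 Cx Cy|Cc x y t /set_mem Cx /set_mem Cy].
  have := Cc x y (Itv01 t0 t1) (mem_set Cx) (mem_set Cy).
  by move=> /set_mem.
by apply/mem_set/Cc.
Qed.

Section Projection.
Context {R : realType} {V : hilbertType R}.
Implicit Types (x y z : V) (C : set V).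

Lemma exists_nearest_point C x : C !=set0 -> closed C -> convex_set C ->
  exists y, C y /\ forall z, C z -> `|x - y| <= `|x - z|.
Proof.
move=> [z0 Cz0] Ccl /convex_setP Ccv.
pose D : set R := [set `|x - z| ^+ 2 | z in C].
have hD : has_inf D.
  split; first by exists (`|x - z0| ^+ 2), z0.
  by exists 0 => _ [z _ <-]; exact: sqr_ge0.
have infD z : C z -> inf D <= `|x - z| ^+ 2.
  by move=> Cz; apply: ge_inf; [exact: (proj2 hD)|exists z].
pose h : nat -> R := harmonic.
have h_gt0 n : 0 < h n by rewrite /h /harmonic /= invr_gt0 ltr0n.
have h_le n m : (n <= m)%N -> h m <= h n.
  by move=> nm; rewrite /h /harmonic /= lef_pV2 ?posrE ?ltr0n // ler_nat ltnS.
have /choice [y yP] : forall n,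
    exists y, C y /\ `|x - y| ^+ 2 <= inf D + h n ^+ 2 / 4.
  move=> n; have h4 : 0 < h n ^+ 2 / 4 by rewrite divr_gt0 ?exprn_gt0.
  have [_ [z Cz <-] zlt] := inf_adherent h4 hD.
  by exists z; split => //; exact: ltW.
(* The parallelogram identity turns nearly minimal distances into small
   mutual distances, since midpoints stay in C. *)
have yy n m : (n <= m)%N -> `|y n - y m| <= h n.
  move=> nm; rewrite -(ler_pXn2r (ltn0Sn 1)) ?nnegrE ?(ltW (h_gt0 n)) //.
  have [Cn yn] := yP n; have [Cm ym] := yP m.
  have hnm : h m ^+ 2 <= h n ^+ 2.
    by rewrite ler_pXn2r ?nnegrE ?(ltW (h_gt0 _)) ?h_le.
  have half0 : 0 <= 2^-1 :> R by lra.
  have half1 : 2^-1 <= 1 :> R by lra.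
  have := infD _ (Ccv _ _ _ half0 half1 Cn Cm).
  move: yn ym; rewrite !sqr_norm !innerE.
  by rewrite !(innerC (y _) x) (innerC (y m) (y n)); lra.
have [l [yl ly]] := cauchy_rate_cvg _ _ _ _ cvg_harmonic yy.
exists l; split.
  by apply: (closed_cvg C Ccl _ l yl); exists 0%N => // n _; exact: (yP n).1.
move=> z Cz.
apply: (@ler_add_cvg0 _ _ _ (fun n => 2 * h n)).
  by rewrite -(mulr0 2); exact: cvgMl_tmp cvg_harmonic.
move=> n; have xn : `|x - y n| <= `|x - z| + h n.
  rewrite -(ler_pXn2r (ltn0Sn 1)) ?nnegrE ?addr_ge0 ?(ltW (h_gt0 n)) //.
  have := (yP n).2; have := infD _ Cz; have := h_gt0 n.
  have := normr_ge0 (x - z); nra.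
have -> : x - l = (x - y n) + (y n - l) by rewrite addrA subrK.
apply: le_trans (ler_normD _ _) _.
by have := ly n; rewrite -/(h n) => hl; lra.
Qed.

Lemma proj_spec C x : C !=set0 -> closed C -> convex_set C ->
  C (Defs.proj C x) /\ forall z, C z -> `|x - Defs.proj C x| <= `|x - z|.
Proof.
move=> C0 Ccl Ccv.
exact: (xgetPex 0 (exists_nearest_point _ x C0 Ccl Ccv)).
Qed.

(** Otherwise a short move from [y] towards [z] would decrease the distance
    to [x]; the length of the move is chosen to make this quantitative. *)
Lemma nearest_point_obtuse C x y z : convex_set C -> C y ->
  (forall z, C z -> `|x - y| <= `|x - z|) -> C z -> inner (x - y) (z - y) <= 0.
Proof.
move=> /convex_setP Ccv Cy ymin Cz.
rewrite leNgt; apply/negP.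
have := ymin _ (Ccv z y _ _ _ Cz Cy).
have mv t : x - (t *: z + (1 - t) *: y) = (x - y) - t *: (z - y).
  by rewrite scalerBl scale1r scalerBr addrCA opprD addrA.
move: (x - y) (z - y) mv => u w mv ht; set g := inner u w => g_gt0.
set n := inner w w; have n0 : 0 <= n by exact: inner_ge0.
pose t := g / (n + g).
have ng0 : 0 < n + g by lra.
have t0 : 0 < t by rewrite divr_gt0.
have t1 : t <= 1 by rewrite /t ler_pdivrMr // mul1r; lra.
have := ht _ (ltW t0) t1.
rewrite mv -(ler_pXn2r (ltn0Sn 1)) ?nnegrE // !sqr_norm !innerE.
rewrite (innerC w u) -/g -/n => le_uu.
have tn : t * n <= g.
  have -> : t * n = g - t * g by rewrite /t; field; rewrite gt_eqF.
  by rewrite gerBl mulr_ge0 // ltW.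
have : 0 < t * (2 * g - t * n) by apply: mulr_gt0 => //; lra.
lra.
Qed.

End Projection.

(** * Adjoints and operator norms *)

Lemma closed_approx (R : realType) (V : normedModType R) (C : set V) :
  (forall x, (forall e : R, 0 < e -> exists z, C z /\ `|x - z| <= e) -> C x) ->
  closed C.
Proof.
move=> Capprox x xC; apply: Capprox => e e0.
have [z [Cz]] := xC _ (nbhsx_ballx x e e0).
by rewrite -ball_normE /= => xz; exists z; split=> //; exact: ltW.
Qed.

(** The representing vector is a multiple of the shortest element [n] of
    the hyperplane [f = 1], because [n] is orthogonal to the kernel of [f]. *)
Lemma riesz_representation (R : realType) (V : hilbertType R) (f : V -> R)
    (K : R) : (forall a x y, f (a *: x + y) = a * f x + f y) ->
  (forall x, `|f x| <= K * `|x|) -> exists z, forall x, f x = inner x z.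
Proof.
move=> flin fK.
have fZ a x : f (a *: x) = a * f x.
  have f0 : f 0 = 0 by have := flin 1 0 0; rewrite scale1r addr0; lra.
  by rewrite -[a *: x]addr0 flin f0 addr0.
have fD x y : f (x + y) = f x + f y.
  by rewrite -[x]scale1r flin mul1r scale1r.
have [f0|] := pselect (forall x, f x = 0).
  by exists 0 => x; rewrite f0 inner0r.
move=> /existsNP [u /eqP fu0].
pose C := [set x | f x = 1].
have C0 : C !=set0 by exists ((f u)^-1 *: u); rewrite /C /= fZ mulVf.
have Ccl : closed C.
  apply: closed_approx => x xC; rewrite /C /=.
  apply/eqP; rewrite -subr_eq0 -normr_le0.
  apply/ler_addgt0Pr => e e0; rewrite add0r.
  have K1 : 0 < `|K| + 1 by have := normr_ge0 K; lra.
  have [z [Cz xz]] := xC (e / (`|K| + 1)) (divr_gt0 e0 K1).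
  have -> : f x - 1 = f (x - z).
    by rewrite -(scaleN1r z) fD fZ Cz mulN1r.
  apply: le_trans (fK _) _; rewrite ler_pdivlMr // in xz.
  have := ler_norm K; have := normr_ge0 (x - z); nra.
have Ccv : convex_set C.
  by apply/convex_setP => x y t _ _ Cx Cy; rewrite /C /= flin fZ Cx Cy; ring.
have [Cn nmin] := proj_spec _ 0 C0 Ccl Ccv.
set n := Defs.proj C 0 in Cn nmin.
have n_neq0 : inner n n != 0.
  apply/eqP => nn; have n0 : n = 0.
    by apply/eqP; rewrite -normr_eq0 -sqrf_eq0 sqr_norm nn.
  have := Cn; rewrite /C /= n0 => f01.
  by have := fZ 0 0; rewrite scale0r mul0r f01 => /eqP; rewrite oner_eq0.
exists ((inner n n)^-1 *: n) => x; rewrite innerZr.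
have nC y : f y = 0 -> 0 <= inner n y.
  move=> fy; have Cny : C (n + y) by rewrite /C /= fD fy Cn addr0.
  have := nearest_point_obtuse _ _ _ _ Ccv Cn nmin Cny.
  by rewrite sub0r innerNl [n + y]addrC addrK oppr_le0.
pose v := x - f x *: n.
have fv : f v = 0.
  by rewrite /v -(scaleN1r (f x *: n)) fD !fZ Cn; ring.
have := nC v fv; have := nC (- v).
rewrite -(scaleN1r v) fZ fv mulr0 innerZr => /(_ erefl) hN hP.
have : inner n v = 0 by lra.
rewrite /v innerBr innerZr (innerC n x) => /subr0_eq ->.
by rewrite mulrCA mulVf ?mulr1.
Qed.

Section OperatorNorm.
Context {R : realType} {V W : hilbertType R} (A : {linear V -> W}).
Hypothesis A_bounded : bounded_fun_norm A.

Let unit_values := [set `|A x| | x in [set x : V | `|x| <= 1]].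

Let has_sup_unit_values : has_sup unit_values.
Proof.
split; first by exists `|A 0|; exists 0 => //=; rewrite normr0.
by have [M AM] := A_bounded 1; exists M => _ [x x1 <-]; exact: AM.
Qed.

Lemma opnorm_ge0 : 0 <= opnorm A.
Proof.
apply: (sup_upper_bound has_sup_unit_values).
by exists 0; rewrite /= ?linear0 normr0.
Qed.

Lemma ler_opnorm x : `|A x| <= opnorm A * `|x|.
Proof.
have [->|x0] := eqVneq x 0; first by rewrite linear0 !normr0 mulr0.
have x_gt0 : 0 < `|x| by rewrite normr_gt0.
rewrite -ler_pdivrMr //; apply: (sup_upper_bound has_sup_unit_values).
exists (`|x|^-1 *: x).
  by rewrite /= normrZ ger0_norm ?invr_ge0 // mulVf ?gt_eqF.
by rewrite linearZ normrZ ger0_norm ?invr_ge0 // mulrC.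
Qed.

Lemma opnorm_gt0 : (exists x, A x != 0) -> 0 < opnorm A.
Proof.
move=> [x Ax0]; have x0 : x != 0.
  by apply: contraNneq Ax0 => ->; rewrite linear0.
have := ler_opnorm x; rewrite -ler_pdivrMr ?normr_gt0 //.
by apply: lt_le_trans; rewrite divr_gt0 ?normr_gt0.
Qed.

Lemma adjointP x y : inner (A x) y = inner x (adjoint A y).
Proof.
apply: (xgetPex 0 (P := [set z | forall x, inner (A x) y = inner x z])).
apply: (@riesz_representation _ _ _ (opnorm A * `|y|)).
  by move=> a u v; rewrite linearP innerDl innerZl.
move=> u; apply: le_trans (ler_inner _ _) _.
by rewrite mulrAC ler_wpM2r // ler_opnorm.
Qed.

Lemma ler_norm_adjoint y : `|adjoint A y| <= opnorm A * `|y|.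
Proof.
have [->|z0] := eqVneq (adjoint A y) 0.
  by rewrite normr0 mulr_ge0 ?opnorm_ge0.
have z_gt0 : 0 < `|adjoint A y| by rewrite normr_gt0.
rewrite -(ler_pM2r z_gt0) -expr2 sqr_norm -adjointP.
apply: le_trans (inner_le _ _) _.
by rewrite mulrAC ler_wpM2r // ler_opnorm.
Qed.

End OperatorNorm.

(** * Hoffman error bound for finite systems of linear inequalities *)

Lemma seq_upper_bound (R : realDomainType) (T : eqType) (f : T -> R)
    (s : seq T) : exists B, 0 <= B /\ forall c, c \in s -> f c <= B.
Proof.
elim: s => [|a s [B [B0 fB]]]; first by exists 0.
exists (Num.max (f a) B); split; first by rewrite le_max B0 orbT.
move=> c; rewrite inE => /predU1P[->|/fB cB]; rewrite le_max ?lexx //.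
by rewrite cB orbT.
Qed.

(** The largest element of [L] and [- tau] is such a point. *)
Lemma small_separating_point (R : realDomainType) (tau : R) (L U : seq R) :
  0 <= tau -> (forall l, l \in L -> l <= tau) ->
  (forall u, u \in U -> - tau <= u) ->
  (forall l u, l \in L -> u \in U -> l <= u) ->
  exists t, [/\ `|t| <= tau, forall l, l \in L -> l <= t &
    forall u, u \in U -> t <= u].
Proof.
move=> tau0; elim: L => [|a L IH] Ltau tauU LU.
  exists (- tau); split=> //; first by rewrite normrN ger0_norm.
have [|//||t [tt Lt tU]] := IH.
- by move=> l lL; apply: Ltau; rewrite inE lL orbT.
- by move=> l u lL; apply: LU; rewrite inE lL orbT.
have atau : a <= tau by apply: Ltau; rewrite mem_head.
exists (Num.max a t); split.
- move: tt; rewrite !ler_norml => /andP[h1 h2].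
  by rewrite le_max h1 orbT ge_max atau h2.
- move=> l; rewrite inE => /predU1P[->|/Lt lt]; rewrite le_max ?lexx //.
  by rewrite lt orbT.
- by move=> u uU; rewrite ge_max (tU _ uU) LU ?mem_head.
Qed.

Section LinearSpan.
Context {R : realType} {V : lmodType R}.
Implicit Types (s : seq V) (u v : V).

(** Recursion on the spanning list, because elimination removes one spanning
    vector at a time. *)
Fixpoint in_span s u : Prop :=
  if s is e :: s' then exists a, in_span s' (u - a *: e) else u = 0.

Lemma in_span_linear s a u v :
  in_span s u -> in_span s v -> in_span s (a *: u + v).
Proof.
elim: s u v => [|e s IH] u v /=; first by move=> -> ->; rewrite scaler0 addr0.
move=> [b ub] [c vc]; exists (a * b + c).
have -> : a *: u + v - (a * b + c) *: e = a *: (u - b *: e) + (v - c *: e).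
  by rewrite scalerBr scalerA scalerDl opprD addrACA.
exact: IH.
Qed.

Lemma in_span_map (f : {linear V -> V}) s u :
  in_span s u -> in_span (map f s) (f u).
Proof.
elim: s u => [|e s IH] u /=; first by move=> ->; rewrite linear0.
by move=> [a /IH]; rewrite linearB linearZ; exists a.
Qed.

Lemma in_span0 s : in_span s 0.
Proof. by elim: s => [//|e s IH]; exists 0; rewrite scale0r subr0. Qed.

Lemma in_span_mem s u : u \in s -> in_span s u.
Proof.
elim: s => [//|e s IH]; rewrite inE => /predU1P[->|us] /=.
  by exists 1; rewrite scale1r subrr; exact: in_span0.
by exists 0; rewrite scale0r subr0; exact: IH.
Qed.

End LinearSpan.

Section Hoffman.
Context {R : realType} {V : hilbertType R}.
Implicit Types (F : seq (V * R)) (c d : V * R) (x y : V).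

Definition solutions F : set V :=
  [set x | forall c, c \in F -> inner c.1 x <= c.2].

Section Elimination.
Variable e : V.

Let slope c := inner c.1 e.

(** Moving from [y] along [e] by [t], the inequality [c] becomes
    [t <= threshold c y] if its slope is positive and [threshold c y <= t]
    if its slope is negative. *)
Let threshold c y := (slope c)^-1 * (c.2 - inner c.1 y).

Let combination c d : V * R :=
  ((slope c)^-1 *: c.1 - (slope d)^-1 *: d.1,
   (slope c)^-1 * c.2 - (slope d)^-1 * d.2).

(** The system after elimination of the direction [e]: all lower thresholds
    are below all upper ones. *)
Definition eliminate F : seq (V * R) :=
  [seq c <- F | slope c == 0] ++
  [seq combination c d | c <- [seq c <- F | 0 < slope c],
                         d <- [seq d <- F | slope d < 0]].

Lemma in_eliminate F c : c \in eliminate F ->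
  (c \in F /\ slope c = 0) \/
  exists c1 c2, [/\ c1 \in F, c2 \in F, 0 < slope c1, slope c2 < 0 &
    c = combination c1 c2].
Proof.
rewrite mem_cat => /orP[|/allpairsP[[c1 c2] /= []]].
  by rewrite mem_filter => /andP[/eqP c0 cF]; left.
rewrite !mem_filter => /andP[p1 c1F] /andP[n2 c2F] ->.
by right; exists c1, c2.
Qed.

Let combinationE c d y :
  (combination c d).2 - inner (combination c d).1 y =
  threshold c y - threshold d y.
Proof. by rewrite /threshold /= !innerE; ring. Qed.

Lemma eliminate_orthogonal F c : c \in eliminate F -> inner c.1 e = 0.
Proof.
case/in_eliminate => [[_ //]|[c1 [c2 [_ _ p1 n2 ->]]]].
rewrite /= !innerE -/(slope c1) -/(slope c2).
by rewrite (mulVf (lt0r_neq0 p1)) (mulVf (ltr0_neq0 n2)) subrr.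
Qed.

Lemma solutions_eliminate F : solutions F `<=` solutions (eliminate F).
Proof.
move=> y Fy c /in_eliminate[[/Fy //]|[c1 [c2 [/Fy y1 /Fy y2 p1 n2 ->]]]].
rewrite -subr_ge0 combinationE subr_ge0.
apply: (@le_trans _ _ 0); rewrite /threshold.
  by rewrite mulr_le0_ge0 ?invr_le0 ?(ltW n2) // subr_ge0.
by rewrite mulr_ge0 ?invr_ge0 ?(ltW p1) // subr_ge0.
Qed.

Let threshold_slack c x B rho : `|(slope c)^-1| <= B -> 0 <= rho ->
  inner c.1 x <= c.2 + rho ->
  (0 < slope c -> - (B * rho) <= threshold c x) /\
  (slope c < 0 -> threshold c x <= B * rho).
Proof.
move=> cB rho0 xc; rewrite /threshold; split=> [p|n].
- have := cB; rewrite ger0_norm ?invr_ge0 ?(ltW p) // => {}cB.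
  have : 0 <= (slope c)^-1 by rewrite invr_ge0 ltW.
  nra.
- have := cB; rewrite ler0_norm ?invr_le0 ?(ltW n) // => {}cB.
  have : (slope c)^-1 <= 0 by rewrite invr_le0 ltW.
  nra.
Qed.

Let threshold_lipschitz c x y N : `|(slope c)^-1| * `|c.1| <= N ->
  `|threshold c y - threshold c x| <= N * `|x - y|.
Proof.
move=> cN; have -> : threshold c y - threshold c x = (slope c)^-1 * inner c.1 (x - y).
  by rewrite /threshold innerBr; ring.
rewrite normrM; apply: le_trans (ler_wpM2r (normr_ge0 _) cN).
by rewrite -mulrA ler_wpM2l // ler_inner.
Qed.

(** Once the eliminated system holds at [y], a suitable multiple of [e]
    repairs the remaining inequalities, and its size is controlled by how
    badly they fail at [y]. *)
Lemma lift_error_bound F kappa' : 0 <= kappa' ->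
  (forall x rho, 0 <= rho ->
    (forall c, c \in eliminate F -> inner c.1 x <= c.2 + rho) ->
    exists y, solutions (eliminate F) y /\ `|x - y| <= kappa' * rho) ->
  exists kappa, 0 <= kappa /\ forall x rho, 0 <= rho ->
    (forall c, c \in F -> inner c.1 x <= c.2 + rho) ->
    exists y, solutions F y /\ `|x - y| <= kappa * rho.
Proof.
move=> kappa0 IH.
have [B [B0 FB]] := seq_upper_bound _ _ (fun c => `|(slope c)^-1|) F.
have [N [N0 FN]] := seq_upper_bound _ _ (fun c => `|(slope c)^-1| * `|c.1|) F.
pose sigma := 2 * B + 1; have sigma0 : 0 <= sigma by rewrite /sigma; lra.
pose tau := B + N * (kappa' * sigma).
have tau0 : 0 <= tau by rewrite /tau addr_ge0 ?mulr_ge0.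
exists (kappa' * sigma + tau * `|e|); split.
  by rewrite addr_ge0 ?mulr_ge0.
move=> x rho rho0 xF.
have slack c cF := threshold_slack c x B rho (FB c cF) rho0 (xF c cF).
have [c /in_eliminate[[cF _]|]|y [yF xy]] := IH x (sigma * rho) (mulr_ge0 sigma0 rho0).
- apply: le_trans (xF _ cF) _; rewrite lerD2l /sigma.
  by rewrite mulrDl mul1r lerDr !mulr_ge0.
- move=> [c1 [c2 [c1F c2F p1 n2 ->]]].
  rewrite -lerBlDl -opprB lerNl combinationE.
  have := (slack _ c1F).1 p1; have := (slack _ c2F).2 n2.
  by rewrite /sigma; lra.
have lip c cF := threshold_lipschitz c x y N (FN c cF).
have Nxy : N * `|x - y| <= N * (kappa' * (sigma * rho)) by rewrite ler_wpM2l.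
have tauE : tau * rho = B * rho + N * (kappa' * (sigma * rho)).
  by rewrite /tau; ring.
have [||||t [t_le Lt tU]] := @small_separating_point R (tau * rho)
    [seq threshold c y | c <- F & slope c < 0]
    [seq threshold c y | c <- F & 0 < slope c].
- exact: mulr_ge0.
- move=> _ /mapP[c + ->]; rewrite mem_filter => /andP[n cF].
  have := (slack _ cF).2 n; have := lip _ cF; rewrite ler_norml => /andP[_].
  by lra.
- move=> _ /mapP[c + ->]; rewrite mem_filter => /andP[p cF].
  have := (slack _ cF).1 p; have := lip _ cF; rewrite ler_norml => /andP[+ _].
  by lra.
- move=> _ _ /mapP[d dF ->] /mapP[c cF ->].
  rewrite -subr_ge0 -combinationE subr_ge0; apply: yF.
  by rewrite mem_cat; apply/orP; right; apply: allpairs_f.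
exists (y + t *: e); split; last first.
  rewrite opprD addrA; apply: le_trans (ler_normB _ _) _.
  rewrite mulrDl -mulrA; apply: lerD => //.
  by rewrite normrZ mulrAC ler_wpM2r.
move=> c cF; rewrite innerDr innerZr -/(slope c).
have thE : slope c != 0 -> inner c.1 y = c.2 - slope c * threshold c y.
  by move=> s0; rewrite /threshold mulrA divff // mul1r subKr.
have [n|p|s0] := ltgtP (slope c) 0.
- have : threshold c y <= t by apply/Lt/map_f; rewrite mem_filter n.
  by rewrite thE ?lt_eqF //; nra.
- have : t <= threshold c y by apply/tU/map_f; rewrite mem_filter p.
  by rewrite thE ?gt_eqF //; nra.
- rewrite s0 mulr0 addr0; apply: yF.
  by rewrite mem_cat mem_filter s0 eqxx cF.
Qed.

Let reject_map (u : V) := u - (inner u e / inner e e) *: e.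

Let reject_linear : linear reject_map.
Proof.
move=> a u v; rewrite /reject_map innerDl innerZl scalerBr scalerA.
by rewrite mulrDl scalerDl opprD addrACA mulrA.
Qed.

HB.instance Definition _ :=
  GRing.isLinear.Build R V V *:%R reject_map reject_linear.

(** The images of [s] under the projection along [e], which fixes the
    vectors orthogonal to [e] and kills [e]. *)
Lemma in_span_orthogonal s : exists s', size s' = size s /\
  forall u, in_span (e :: s) u -> inner u e = 0 -> in_span s' u.
Proof.
exists (map reject_map s); split; first by rewrite size_map.
move=> u [a us] ue; have := in_span_map reject_map _ _ us.
have re : reject_map e = 0.
  have [->|e0] := eqVneq e 0; first exact: linear0.
  rewrite /reject_map divff ?scale1r ?subrr //.
  by rewrite -sqr_norm sqrf_eq0 normr_eq0.
rewrite linearB linearZ /= re scaler0 subr0.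
by rewrite /reject_map ue mul0r scale0r subr0.
Qed.

End Elimination.

(** Each elimination makes all normals orthogonal to [e], so the dimension
    of their span drops, until all of them vanish. *)
Lemma error_bound_of_span s F :
  (forall c, c \in F -> in_span s c.1) -> solutions F !=set0 ->
  exists kappa, 0 <= kappa /\ forall x rho, 0 <= rho ->
    (forall c, c \in F -> inner c.1 x <= c.2 + rho) ->
    exists y, solutions F y /\ `|x - y| <= kappa * rho.
Proof.
elim: {s}(size s) {-2}s (erefl (size s)) F => [|n IH] [|e s] //= => [_ F Fs|[sn] F Fs] [x0 Fx0].
  exists 0; split=> // x rho _ _; exists x; split.
    by move=> c cF; have := Fx0 _ cF; rewrite (Fs _ cF) !inner0l.
  by rewrite subrr normr0 mul0r.
have [s' [ss' Hs']] := in_span_orthogonal e s.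
have [||| kappa' [kappa0 IHF]] := IH s' _ (eliminate e F).
- by rewrite ss'.
- move=> c cF; apply: Hs'; last exact: (eliminate_orthogonal e F).
  case/in_eliminate: cF => [[/Fs //]|[c1 [c2 [/Fs c1s /Fs c2s _ _ ->]]]].
  rewrite /= -scaleNr; apply: (in_span_linear (e :: s)) => //.
  rewrite -[_ *: c2.1]addr0; apply: (in_span_linear (e :: s)) => //.
  exact: in_span0.
- by exists x0; apply: solutions_eliminate.
exact: (lift_error_bound e F kappa' kappa0).
Qed.

Theorem hoffman_error_bound F : solutions F !=set0 ->
  exists kappa, 0 <= kappa /\ forall x rho, 0 <= rho ->
    (forall c, c \in F -> inner c.1 x <= c.2 + rho) ->
    exists y, solutions F y /\ `|x - y| <= kappa * rho.
Proof.
apply: (error_bound_of_span (map fst F)) => c cF.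
exact/in_span_mem/map_f.
Qed.

Lemma solutions_closed F : closed (solutions F).
Proof.
apply: closed_approx => x xF c cF; apply/ler_addgt0Pr => d d0.
have n1 : 0 < `|c.1| + 1 by have := normr_ge0 c.1; lra.
have [z [zF xz]] := xF (d / (`|c.1| + 1)) (divr_gt0 d0 n1).
rewrite ler_pdivlMr // in xz.
have := inner_le c.1 (x - z); rewrite innerBr.
have := zF _ cF; have := normr_ge0 (x - z); have := normr_ge0 c.1; nra.
Qed.

Lemma solutions_convex F : convex_set (solutions F).
Proof.
apply/convex_setP => x y t t0 t1 xF yF c cF; rewrite innerDr !innerZr.
have := xF _ cF; have := yF _ cF; nra.
Qed.

End Hoffman.

(** * One step of the iteration *)

Lemma polyhedral_solutions (R : realType) (V : hilbertType R) (C : set V) :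
  polyhedral C -> exists F, C = solutions F.
Proof.
move=> [n [S [/choice[a aP] ->]]].
have [beta abP] := choice aP.
exists [seq (a j, beta j) | j <- enum 'I_n].
apply/seteqP; split=> x.
  move=> Sx _ /mapP[j _ ->] /=; have := Sx j I.
  by rewrite (proj2 (abP j)).
move=> Fx j _; rewrite (proj2 (abP j)) /=.
by apply: (Fx (a j, beta j)); apply/mapP; exists j; rewrite ?mem_enum.
Qed.

(** Testing [A x = b] against finitely many vectors that span the codomain
    gives pairs of opposite inequalities. *)
Lemma linear_equation_solutions (R : realType) (V W : hilbertType R)
    (A : {linear V -> W}) (b : W) :
  finite_dimensional W -> bounded_fun_norm A ->
  exists F N, [/\ 0 <= N, [set x | A x = b] = solutions F &
    forall x c, c \in F -> inner c.1 x <= c.2 + N * `|b - A x|].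
Proof.
move=> [n [e e_span]] A_bnd.
pose F1 : seq (V * R) := [seq (adjoint A (e i), inner b (e i)) | i <- enum 'I_n].
pose F2 : seq (V * R) :=
  [seq (- adjoint A (e i), - inner b (e i)) | i <- enum 'I_n].
have [N [N0 eN]] := seq_upper_bound _ _ (fun i => `|e i|) (enum 'I_n).
have adjE x i : inner (adjoint A (e i)) x = inner (A x) (e i).
  by rewrite (adjointP A A_bnd) innerC.
exists (F1 ++ F2), N; split=> //.
- apply/seteqP; split=> x.
    move=> Axb c; rewrite mem_cat => /orP[] /mapP[i _ ->] /=.
      by rewrite adjE Axb.
    by rewrite innerNl adjE Axb.
  move=> Fx; have ei i : inner (A x - b) (e i) = 0.
    rewrite innerBl; have := Fx (adjoint A (e i), inner b (e i)).
    have := Fx (- adjoint A (e i), - inner b (e i)); rewrite /= innerNl adjE.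
    move=> h2 h1; apply/le_anti/andP; split; rewrite ?subr_le0 ?subr_ge0.
      by apply: h1; rewrite mem_cat; apply/orP; left; rewrite map_f ?mem_enum.
    rewrite -lerN2; apply: h2; rewrite mem_cat; apply/orP; right.
    by apply/mapP; exists i; rewrite ?mem_enum.
  apply/eqP; rewrite -subr_eq0; apply/eqP/inner_eq0_all => z.
  have [c ->] := e_span z.
  elim/big_ind: _ => [|u v u0 v0|i _]; first by rewrite inner0r.
    by rewrite innerDr u0 v0 addr0.
  by rewrite innerZr ei mulr0.
move=> x c; rewrite mem_cat => /orP[] /mapP[i ie ->] /=.
  rewrite adjE -lerBlDl -innerBl -opprB innerNl -innerNr.
  apply: le_trans (inner_le _ _) _.
  by rewrite mulrC normrN ler_wpM2r ?eN.
rewrite innerNl adjE -lerBlDl opprK addrC -innerBl.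
by apply: le_trans (inner_le _ _) _; rewrite mulrC ler_wpM2r ?eN.
Qed.

(** The factor by which a relaxed step decreases squared distances stays
    bounded away from zero. *)
Lemma relaxation_factor_ge (R : realDomainType) (eps t : R) :
  0 < eps -> eps <= t <= 2 - eps -> eps ^+ 2 <= t * (2 - t).
Proof. by move=> e0 /andP[h1 h2]; nra. Qed.

Lemma landweber_step (R : realType) (V W : hilbertType R)
    (A : {linear V -> W}) (b : W) (eps lambda : R) (x : V) :
  bounded_fun_norm A -> (exists x, A x != 0) ->
  0 < eps -> eps <= lambda <= 2 - eps ->
  let y := x + (lambda / opnorm A ^+ 2) *: adjoint A (b - A x) in
  let s := `|b - A x| / opnorm A in
  (forall w, A w = b -> `|y - w| ^+ 2 + (eps * s) ^+ 2 <= `|x - w| ^+ 2) /\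
  `|y - x| <= 2 * s.
Proof.
move=> A_bnd A0 eps0 lambdaP y s.
have L0 : 0 < opnorm A by exact: opnorm_gt0.
have s0 : 0 <= s by rewrite divr_ge0 // ltW.
have sE : `|b - A x| = s * opnorm A by rewrite divfK ?gt_eqF.
have lambda0 : 0 <= lambda by lra.
have yx : `|y - x| <= lambda * s.
  rewrite /y [x + _]addrC addrK normrZ ger0_norm; last first.
    by rewrite divr_ge0 // exprn_ge0 // ltW.
  have := ler_norm_adjoint A A_bnd (b - A x); rewrite sE => h.
  apply: le_trans (ler_wpM2l _ h) _; first by rewrite divr_ge0 // exprn_ge0 // ltW.
  rewrite le_eqVlt; apply/orP; left; apply/eqP; field; exact: lt0r_neq0.
split=> [w Aw|]; last by apply: le_trans yx _; rewrite ler_wpM2r //; lra.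
have cross : inner (y - x) (x - w) = - (lambda * s ^+ 2).
  rewrite /y [x + _]addrC addrK innerZl innerC -(adjointP A A_bnd).
  rewrite (linearB A) Aw -opprB innerNl -sqr_norm sE.
  by field; exact: lt0r_neq0.
have -> : y - w = (y - x) + (x - w) by rewrite addrA subrK.
move: (y - x) (x - w) yx cross => u v ux cross.
rewrite [`|u + v| ^+ 2]sqr_norm !innerE (innerC v u) cross -!sqr_norm.
have : `|u| ^+ 2 <= (lambda * s) ^+ 2.
  by rewrite (ler_pXn2r (ltn0Sn 1)) ?nnegrE ?(mulr_ge0 lambda0 s0).
have : eps ^+ 2 * s ^+ 2 <= lambda * (2 - lambda) * s ^+ 2.
  by rewrite ler_wpM2r ?sqr_ge0 ?relaxation_factor_ge.
rewrite !exprMn; lra.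
Qed.

Lemma relaxed_proj_step (R : realType) (V : hilbertType R) (C : set V)
    (eps mu : R) (y : V) :
  C !=set0 -> closed C -> convex_set C -> 0 < eps -> eps <= mu <= 2 - eps ->
  let z := relaxed_proj C mu y in
  let d := `|y - Defs.proj C y| in
  (forall w, C w -> `|z - w| ^+ 2 + (eps * d) ^+ 2 <= `|y - w| ^+ 2) /\
  `|z - y| <= 2 * d.
Proof.
move=> C0 Ccl Ccv eps0 muP z d.
have [CP Pmin] := proj_spec C y C0 Ccl Ccv.
set P := Defs.proj C y in CP Pmin.
have d0 : 0 <= d by exact: normr_ge0.
have zE : z = y - mu *: (y - P).
  by rewrite /z /relaxed_proj -/P scalerBl scale1r scalerBr opprB addrA addrAC.
split=> [w Cw|]; last first.
  rewrite zE addrAC subrr add0r normrN normrZ ger0_norm; last by lra.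
  by rewrite ler_wpM2r //; lra.
have := nearest_point_obtuse _ _ _ _ Ccv CP Pmin Cw.
have -> : z - w = (y - w) - mu *: (y - P) by rewrite zE addrAC.
have -> : w - P = (y - P) - (y - w) by rewrite opprB [RHS]addrC addrA subrK.
rewrite /d -/P; move: (y - P) (y - w) => u v.
rewrite innerBr exprMn !sqr_norm !innerE (innerC v u) => uv.
have : eps ^+ 2 * inner u u <= mu * (2 - mu) * inner u u.
  by rewrite ler_wpM2r ?inner_ge0 ?relaxation_factor_ge.
have : mu * inner u u <= mu * inner u v by rewrite ler_wpM2l; lra.
lra.
Qed.

(** The decrease [delta ^+ 2] of the squared distance to every solution
    controls the length of the step and the violation of each inequality at
    the point [x] where the step starts. *)
Lemma step_decrease (R : realType) (V W : hilbertType R) (C : set V)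
    (A : {linear V -> W}) (b : W) (eps : R) :
  finite_dimensional W -> C !=set0 -> polyhedral C -> bounded_fun_norm A ->
  (exists x, A x != 0) -> 0 < eps ->
  exists F M, [/\ 0 <= M, solutions F = [set x | C x /\ A x = b] &
    forall lambda mu x, eps <= lambda <= 2 - eps -> eps <= mu <= 2 - eps ->
      let x' := relaxed_proj C mu
        (x + (lambda / opnorm A ^+ 2) *: adjoint A (b - A x)) in
      exists delta, [/\ 0 <= delta,
        forall w, solutions F w ->
          `|x' - w| ^+ 2 + delta ^+ 2 <= `|x - w| ^+ 2,
        `|x' - x| <= M * delta &
        forall c, c \in F -> inner c.1 x <= c.2 + M * delta]].
Proof.
move=> W_fin C0 /polyhedral_solutions[F1 CE] A_bnd A0 eps0.
have Ccl : closed C by rewrite CE; exact: solutions_closed.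
have Ccv : convex_set C by rewrite CE; exact: solutions_convex.
have [F2 [N [N0 AE F2N]]] := linear_equation_solutions _ _ _ A b W_fin A_bnd.
have [K [K0 F1K]] := seq_upper_bound _ _ (fun c : V * R => `|c.1|) F1.
have L0 : 0 < opnorm A by exact: opnorm_gt0.
have FE : solutions (F1 ++ F2) = [set x | C x /\ A x = b].
  apply/seteqP; split=> x.
    move=> Fx; rewrite /= CE; split.
      by move=> c cF; apply: Fx; rewrite mem_cat cF.
    have : solutions F2 x by move=> c cF; apply: Fx; rewrite mem_cat cF orbT.
    by rewrite -AE.
  rewrite /= CE => -[F1x Axb] c; rewrite mem_cat => /orP[|]; first exact: F1x.
  by move: c; rewrite -[forall c, _]/(solutions F2 x) -AE.
pose M := 4 + 3 * K + N * opnorm A.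
have M0 : 0 <= M by rewrite /M; have := mulr_ge0 N0 (ltW L0); lra.
exists (F1 ++ F2), (M / eps); split=> //; first by rewrite divr_ge0 // ltW.
move=> lambda mu x lambdaP muP x'.
have [] := landweber_step _ _ _ _ b _ _ x A_bnd A0 eps0 lambdaP.
set y := x + _ in x' *; set s := _ / _ => yw yx.
have [] := relaxed_proj_step _ _ _ _ _ y C0 Ccl Ccv eps0 muP.
rewrite -/x'; set d := `|_| => x'w x'y.
(* The maximum of both displacements is dominated by the total decrease and
   dominates each displacement up to a constant. *)
pose m := Num.max s d.
have s0 : 0 <= s by rewrite divr_ge0 // ltW.
have sm : s <= m by rewrite /m le_max lexx.
have dm : d <= m by rewrite /m le_max lexx orbT.
have m0 : 0 <= m by exact: le_trans sm.
have MmE : M / eps * (eps * m) = 4 * m + 3 * K * m + N * opnorm A * m.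
  by rewrite /M; field; exact: lt0r_neq0.
have NLm0 : 0 <= N * opnorm A * m by rewrite !mulr_ge0 // ltW.
have Km0 : 0 <= K * m by exact: mulr_ge0.
exists (eps * m); rewrite MmE; split.
- by rewrite mulr_ge0 // ltW.
- move=> w; rewrite FE => -[Cw Aw]; have := yw w Aw; have := x'w w Cw.
  rewrite /m; have := sqr_ge0 (eps * s); have := sqr_ge0 (eps * d).
  by case: (leP s d) => _; lra.
- have -> : x' - x = (x' - y) + (y - x) by rewrite addrA subrK.
  by apply: le_trans (ler_normD _ _) _; lra.
move=> c; rewrite mem_cat => /orP[cF|cF]; last first.
  apply: le_trans (F2N x c cF) _; rewrite lerD2l.
  have -> : `|b - A x| = s * opnorm A by rewrite divfK ?gt_eqF.
  have := ler_wpM2l (mulr_ge0 N0 (ltW L0)) sm; lra.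
have [CP _] := proj_spec C y C0 Ccl Ccv.
set P := Defs.proj C y in CP.
have Pc : inner c.1 P <= c.2 by move: CP; rewrite CE => /(_ _ cF).
have xP : `|x - P| <= 3 * m.
  have -> : x - P = (y - P) - (y - x).
    by rewrite opprB [RHS]addrC addrA subrK.
  by apply: le_trans (ler_normB _ _) _; rewrite -/d; lra.
have := inner_le c.1 (x - P); rewrite innerBr.
have := ler_pM (normr_ge0 _) (normr_ge0 _) (F1K c cF) xP; lra.
Qed.

(** * Linear convergence of almost cyclic iterations *)

Lemma bernoulli (R : realDomainType) (h : R) (n : nat) :
  0 <= h <= 1 -> 1 - n%:R * h <= (1 - h) ^+ n.
Proof.
move=> /andP[h0 h1]; elim: n => [|n IH]; first by rewrite expr0 mul0r subr0.
rewrite exprS -natr1; have : 0 <= n%:R * (h * h) by rewrite !mulr_ge0.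
have : (1 - h) * (1 - n%:R * h) <= (1 - h) * (1 - h) ^+ n.
  by apply: ler_wpM2l => //; lra.
lra.
Qed.

(** The rate is chosen with [theta <= q ^+ m], by Bernoulli's inequality. *)
Lemma geometric_of_periodic (R : realType) (D : nat -> R) (m : nat) (theta : R) :
  (0 < m)%N -> 0 < theta < 1 -> (forall k, 0 <= D k) ->
  (forall k, D k.+1 <= D k) -> (forall k, D (k + m)%N <= theta * D k) ->
  exists c q, [/\ 0 <= c, 0 < q < 1 & forall k, D k <= c * q ^+ k].
Proof.
move=> m0 /andP[th0 th1] D0 Dmon Dm.
have mR0 : 0 < m%:R :> R by rewrite ltr0n.
have mR1 : 1 <= m%:R :> R by rewrite ler1n.
pose h := (1 - theta) / m%:R.
have mh : m%:R * h = 1 - theta by rewrite /h mulrC divfK // gt_eqF.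
have h0 : 0 < h by rewrite divr_gt0 // subr_gt0.
have h1 : h < 1 by nra.
pose q := 1 - h; have q01 : 0 < q < 1 by rewrite /q; lra.
have [q0 q1] := andP q01.
have thq : theta <= q ^+ m.
  apply: le_trans (bernoulli _ _ m _); last by rewrite (ltW h0) ltW.
  by rewrite mh; lra.
have qm0 : 0 < q ^+ m by rewrite exprn_gt0.
have c0 : 0 <= D 0%N / q ^+ m by rewrite divr_ge0 // ltW.
exists (D 0%N / q ^+ m), q; split=> // k.
have [n] := ubnP k; elim: n k => // n IH k kn.
have [mk|km] := leqP m k; last first.
  have : D k <= D 0%N by elim: {kn km}k => // k; exact: le_trans.
  move/le_trans; apply; rewrite -[leLHS](divfK (lt0r_neq0 qm0)).
  rewrite ler_wpM2l //; apply: ler_wiXn2l (ltnW km); exact: ltW.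
rewrite -(subnK mk); apply: le_trans (Dm _) _.
have kmn : (k - m < n)%N.
  by apply: leq_trans (_ : k <= n)%N => //; rewrite ltn_subrL m0 (leq_trans m0).
rewrite exprD mulrA [leRHS]mulrC.
by apply: ler_pM => //; [exact: ltW|exact: IH].
Qed.

(** Squared distances to solutions never increase, so the total decrease over
    a window of indices that meets every system bounds all residuals of [x k],
    hence, by the Hoffman bound, the squared distance from [x k] to the
    solution set. That distance is thus multiplied by at most a fixed factor
    below one over each window. *)
Lemma almost_cyclic_linear_convergence (R : realType) (V : hilbertType R)
    (p : nat) (F : 'I_p -> seq (V * R)) (idx : nat -> 'I_p) (M : R)
    (x : nat -> V) :
  almost_cyclic idx -> 0 <= M -> \bigcap_i solutions (F i) !=set0 ->
  (forall k, exists delta, [/\ 0 <= delta,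
    forall w, solutions (F (idx k)) w ->
      `|x k.+1 - w| ^+ 2 + delta ^+ 2 <= `|x k - w| ^+ 2,
    `|x k.+1 - x k| <= M * delta &
    forall c, c \in F (idx k) -> inner c.1 (x k) <= c.2 + M * delta]) ->
  exists l, (\bigcap_i solutions (F i)) l /\ converges_linearly x l.
Proof.
move=> [s _ cyc] M0 Omega0 /choice[delta step].
pose G := flatten [seq F i | i <- enum 'I_p].
have GP c : c \in G <-> exists i, c \in F i.
  split=> [/flatten_mapP[i _ cF]|[i cF]]; first by exists i.
  by apply/flatten_mapP; exists i; rewrite ?mem_enum.
have GE : \bigcap_i solutions (F i) = solutions G.
  apply/seteqP; split=> w; first by move=> Fw c /GP[i cF]; exact: (Fw i).
  by move=> Gw i _ c cF; apply: Gw; apply/GP; exists i.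
rewrite GE in Omega0 *.
have Gcl := solutions_closed G; have Gcv := solutions_convex G.
have delta0 k : 0 <= delta k by case: (step k).
have decr k w : solutions G w ->
    `|x k.+1 - w| ^+ 2 + delta k ^+ 2 <= `|x k - w| ^+ 2.
  by rewrite -GE => Gw; have [_ + _ _] := step k; apply; exact: Gw.
pose total k n := \sum_(j < n) delta (k + j)%N ^+ 2.
have decr_total k n w : solutions G w ->
    `|x (k + n)%N - w| ^+ 2 + total k n <= `|x k - w| ^+ 2.
  move=> Gw; elim: n => [|n IH].
    by rewrite /total big_ord0 addn0 addr0.
  rewrite /total big_ord_recr /= -/(total k n) addnS.
  by have := decr (k + n)%N w Gw; lra.
have total_ge0 k n : 0 <= total k n by apply: sumr_ge0 => j _; exact: sqr_ge0.
have fejer k n w : solutions G w -> `|x (k + n)%N - w| <= `|x k - w|.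
  move=> Gw; rewrite -(ler_pXn2r (ltn0Sn 1)) ?nnegrE //.
  by have := decr_total k n w Gw; have := total_ge0 k n; lra.
pose m := s.+1.
have [B [B0 GB]] := seq_upper_bound _ _ (fun c : V * R => `|c.1|) G.
have [kappa [kappa0 hoff]] := hoffman_error_bound G Omega0.
pose N := M + B * (m%:R * M).
have N0 : 0 <= N by rewrite /N addr_ge0 ?mulr_ge0.
have near k : exists w, solutions G w /\
    `|x k - w| <= kappa * (N * Num.sqrt (total k m)).
  set sigma := Num.sqrt _; have sigma0 : 0 <= sigma by exact: sqrtr_ge0.
  have delta_le j : (j < m)%N -> delta (k + j)%N <= sigma.
    move=> jm; rewrite -(ler_pXn2r (ltn0Sn 1)) ?nnegrE // sqr_sqrtr //.
    rewrite /total (bigD1 (Ordinal jm)) //= lerDl.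
    by apply: sumr_ge0 => i _; exact: sqr_ge0.
  have drift j : (j < m)%N -> `|x k - x (k + j)%N| <= j%:R * (M * sigma).
    elim: j => [|j IH] jm; first by rewrite addn0 subrr normr0 mul0r.
    have -> : x k - x (k + j.+1)%N =
        (x k - x (k + j)%N) - (x (k + j).+1 - x (k + j)%N).
      by rewrite opprB addrA subrK addnS.
    apply: le_trans (ler_normB _ _) _; rewrite -natr1 mulrDl mul1r.
    apply: lerD; first exact/IH/ltnW.
    have [_ _ xx _] := step (k + j)%N; apply: le_trans xx _.
    by rewrite ler_wpM2l // delta_le // ltnW.
  apply: hoff => [|c cG]; first exact: mulr_ge0.
  have /GP[i cF] := cG.
  have [j /andP[kj js] ji] := cyc k i.
  have jE : j = (k + (j - k))%N by rewrite subnKC // ltnW.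
  have jm : (j - k < m)%N by rewrite ltnS leq_subLR.
  have [_ _ _ /(_ c)] := step j; rewrite ji => /(_ cF) cj.
  have dj : M * delta j <= M * sigma by rewrite ler_wpM2l // jE delta_le.
  have := inner_le c.1 (x k - x j); rewrite innerBr.
  have mj : `|x k - x j| <= m%:R * (M * sigma).
    rewrite {1}jE; apply: le_trans (drift _ jm) _.
    by rewrite ler_wpM2r ?mulr_ge0 // ler_nat ltnW.
  have := ler_pM (normr_ge0 _) (normr_ge0 _) (GB c cG) mj.
  by rewrite /N; lra.
pose P k := Defs.proj (solutions G) (x k).
have PG k : solutions G (P k) by exact: (proj_spec _ _ Omega0 Gcl Gcv).1.
have Pmin k w : solutions G w -> `|x k - P k| <= `|x k - w|.
  by apply: (proj_spec _ _ Omega0 Gcl Gcv).2.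
pose D k := `|x k - P k|.
have D0 k : 0 <= D k by exact: normr_ge0.
have Dmon k : D k.+1 <= D k.
  by apply: le_trans (Pmin _ _ (PG k)) _; rewrite -addn1; exact: fejer.
pose K := (kappa * N) ^+ 2 + 1.
have K1 : 1 <= K by rewrite /K lerDr sqr_ge0.
have K0 : 0 < K by lra.
(* The squared distance is multiplied by at most 1 - K^-1, and
   theta ^+ 2 is at least that. *)
pose theta := 1 - (2 * K)^-1.
have theta01 : 0 < theta < 1.
  have : (2 * K)^-1 <= 2^-1 by rewrite lef_pV2 ?posrE; lra.
  have : 0 < (2 * K)^-1 by rewrite invr_gt0; lra.
  by rewrite /theta; lra.
have Dm k : D (k + m)%N <= theta * D k.
  have [w [Gw xw]] := near k.
  have Dk : D k <= kappa * N * Num.sqrt (total k m).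
    by rewrite -mulrA; exact: le_trans (Pmin _ _ Gw) xw.
  have DK : D k ^+ 2 <= K * total k m.
    have : D k ^+ 2 <= (kappa * N * Num.sqrt (total k m)) ^+ 2.
      by rewrite (ler_pXn2r (ltn0Sn 1)) ?nnegrE ?(le_trans (D0 k) Dk).
    rewrite exprMn sqr_sqrtr // /K; have := total_ge0 k m; lra.
  have [th0 _] := andP theta01.
  rewrite -(ler_pXn2r (ltn0Sn 1)) ?nnegrE ?(mulr_ge0 (ltW th0)) ?D0 //.
  have : D (k + m)%N ^+ 2 <= `|x (k + m)%N - P k| ^+ 2.
    by rewrite (ler_pXn2r (ltn0Sn 1)) ?nnegrE ?Pmin.
  have : `|x (k + m)%N - P k| ^+ 2 + total k m <= D k ^+ 2.
    exact: decr_total.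
  move=> h1 h2.
  have KV : D k ^+ 2 / K <= total k m by rewrite (ler_pdivrMr _ _ K0) (mulrC _ K).
  have : (theta * D k) ^+ 2 = D k ^+ 2 - D k ^+ 2 / K + ((2 * K)^-1 * D k) ^+ 2.
    by rewrite /theta; field; apply: lt0r_neq0; lra.
  have := sqr_ge0 ((2 * K)^-1 * D k); lra.
have [c [q [c0 q01 Dcq]]] := geometric_of_periodic _ _ m _ (ltn0Sn s) theta01
  D0 Dmon Dm.
have [q0 q1] := andP q01.
have cvg_q a : (fun k => a * q ^+ k) @ \oo --> 0.
  rewrite -(mulr0 a); apply: cvgMl_tmp; apply: cvg_expr.
  by rewrite ger0_norm ?ltW.
have tail k j : (k <= j)%N -> `|x k - x j| <= 2 * c * q ^+ k.
  move=> kj; have -> : x k - x j = (x k - P k) - (x j - P k).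
    by rewrite opprB addrA subrK.
  apply: le_trans (ler_normB _ _) _.
  have xjP : `|x j - P k| <= c * q ^+ k.
    apply: le_trans (Dcq k).
    by have := fejer k (j - k)%N _ (PG k); rewrite subnKC.
  by have : `|x k - P k| <= c * q ^+ k := Dcq k; lra.
have [l [_ xl]] := cauchy_rate_cvg _ _ _ _ (cvg_q (2 * c)) tail.
exists l; split; last first.
  by exists (2 * c), q; split=> //; rewrite mulr_ge0.
move=> a aG; apply: (ler_add_cvg0 _ _ _ _ (cvg_q (`|a.1| * (3 * c)))) => k.
have lP : `|l - P k| <= 3 * c * q ^+ k.
  have -> : l - P k = (x k - P k) - (x k - l).
    by rewrite opprB [RHS]addrC addrA subrK.
  apply: le_trans (ler_normB _ _) _; have := xl k.
  by have : `|x k - P k| <= c * q ^+ k := Dcq k; lra.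
have := inner_le a.1 (l - P k); rewrite innerBr.
have := ler_wpM2l (normr_ge0 a.1) lP; have := PG k a aG; lra.
Qed.

(** * The split feasibility iteration *)

Theorem theorem2p3 (R : realType) (H : hilbertType R) (p : nat)
    (E : 'I_p -> hilbertType R)
    (E_fin : forall i, finite_dimensional (E i))
    (C : 'I_p -> set H)
    (C_neq0 : forall i, C i !=set0)
    (C_closed : forall i, closed (C i))
    (C_convex : forall i, convex_set (C i))
    (A : forall i, {linear H -> E i})
    (A_bounded : forall i, bounded_fun_norm (A i))
    (A_neq0 : forall i, exists x, A i x != 0)
    (b : forall i, E i)
    (Omega_neq0 : feasible_set C A b !=set0)
    (C_polyhedral : forall i, polyhedral (C i))
    (eps : R) (eps01 : 0 < eps < 1)
    (lambda mu : nat -> R)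
    (lambda_bnd : forall k, eps <= lambda k <= 2 - eps)
    (mu_bnd : forall k, eps <= mu k <= 2 - eps)
    (idx : nat -> 'I_p) (idx_cyclic : almost_cyclic idx)
    (x0 : H) (x : nat -> H) (x_init : x 0%N = x0)
    (x_rec : forall k, x k.+1 =
       relaxed_proj (C (idx k)) (mu k)
         (x k + (lambda k / opnorm (A (idx k)) ^+ 2) *:
            adjoint (A (idx k)) (b (idx k) - A (idx k) (x k)))) :
  exists xstar : H, feasible_set C A b xstar /\ converges_linearly x xstar.
Proof.
have /choice[FM FMP] : forall i, exists FM : seq (H * R) * R,
    [/\ 0 <= FM.2, solutions FM.1 = [set x | C i x /\ A i x = b i] &
    forall lambda mu x, eps <= lambda <= 2 - eps -> eps <= mu <= 2 - eps ->
      let x' := relaxed_proj (C i) mu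
        (x + (lambda / opnorm (A i) ^+ 2) *: adjoint (A i) (b i - A i x)) in
      exists delta, [/\ 0 <= delta,
        forall w, solutions FM.1 w ->
          `|x' - w| ^+ 2 + delta ^+ 2 <= `|x - w| ^+ 2,
        `|x' - x| <= FM.2 * delta &
        forall c, c \in FM.1 -> inner c.1 x <= c.2 + FM.2 * delta]].
  move=> i; have [eps0 _] := andP eps01.
  have [F [M FM]] := step_decrease _ _ _ _ (A i) (b i) eps (E_fin i)
    (C_neq0 i) (C_polyhedral i) (A_bounded i) (A_neq0 i) eps0.
  by exists (F, M).
have [M [M0 leM]] := seq_upper_bound _ _ (fun i => (FM i).2) (enum 'I_p).
have OmegaE : \bigcap_i solutions (FM i).1 = feasible_set C A b.
  apply/seteqP; split=> w.
    move=> Fw; split=> [i _|i]; have := Fw i I; have [_ -> _] := FMP i.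
      by case.
    by case.
  by move=> [Cw Aw] i _; have [_ -> _] := FMP i; split; [exact: Cw|exact: Aw].
rewrite -OmegaE in Omega_neq0 *.
apply: (almost_cyclic_linear_convergence _ _ _ _ _ M x idx_cyclic M0 Omega_neq0).
move=> k; have [_ _ step] := FMP (idx k).
have := step _ _ (x k) (lambda_bnd k) (mu_bnd k); rewrite /= -x_rec.
move=> [delta [delta0 decr short resid]].
have le_delta : (FM (idx k)).2 * delta <= M * delta.
  by rewrite ler_wpM2r // leM // mem_enum.
exists delta; split=> //; first exact: le_trans le_delta.
by move=> c /resid /le_trans; apply; rewrite lerD2l.
Qed.
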